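(* \textsc{Broadcast Domination} parameterized by the solution cost $k$ and the maximum out-degree $d$ of the input digraph can be solved in time $k^{k}2^{d^{O(k)}}n^{O(1)}$ on digraphs of order $n$.
   Context: Digraphs are finite and assumed weakly connected. For vertices $u,v$, $d(u,v)$ is the length of a shortest directed path from $u$ to $v$ ($\infty$ if none). A dominating broadcast of $D$ is a function $f:V(D)\to\mathbb{N}$ such that for every vertex $v$ there is a vertex $t$ with $f(t)>0$ and $d(t,v)\le f(t)$; its cost is $\sum_v f(v)$. \textsc{Broadcast Domination}: given $D$ and $k$, decide whether $D$ has a dominating broadcast of cost at most $k$. The out-degree of a vertex is its number of out-neighbors. *)

(* Defs.v *)
From mathcomp Require Import all_boot.

Set Implicit Arguments.
Unset Strict Implicit.
Unset Printing Implicit Defensive.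

(* A digraph is given by its arc relation e; loops are allowed. *)

Section Digraphs.
Variables (V : finType) (e : rel V).
Implicit Types (u v t : V) (f : V -> nat).

Definition weakly_connected : Prop :=
  forall u v, connect (fun x y => e x y || e y x) u v.

Definition max_outdegree : nat := \max_(v : V) #|[pred w | e v w]|.

(* The number of arcs is the size of p; the start vertex is not in p. *)
Definition dipath (r : nat) u v : bool :=
  [exists p : r.-tuple V, [&& path e u p, uniq (u :: p) & last u p == v]].

Lemma connect_dipath u v : connect e u v -> exists r, dipath r u v.
Proof.
case/connectP=> p pth ->; case/shortenP: pth => q qth quniq _.
by exists (size q); apply/existsP; exists (in_tuple q); rewrite qth quniq eqxx.
Qed.

(* None stands for an infinite distance. *)
Definition distance u v : option nat :=
  if @idP (connect e u v) is ReflectT uv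
  then Some (ex_minn (connect_dipath uv)) else None.

Definition dist_le (x : option nat) (m : nat) : bool :=
  if x is Some r then r <= m else false.

Definition dominating_broadcast f : Prop :=
  forall v, exists t, 0 < f t /\ dist_le (distance t v) (f t).

Definition cost f : nat := \sum_(v : V) f v.

Definition broadcast_domination (k : nat) : Prop :=
  exists f, dominating_broadcast f /\ cost f <= k.

End Digraphs.

(* Random access machine under the uniform cost measure.
   Registers hold natural numbers.  The arithmetic is addition, truncated
   subtraction and halving; there is no multiplication, which at unit cost
   would make the machine stronger than a Turing machine up to polynomial
   overhead.  The input is a read-only array, itself accessed through an
   address held in a register. *)

Inductive instr :=
| IConst (i c : nat)     (* R_i := c *)
| IAdd   (i j l : nat)   (* R_i := R_j + R_l *)
| ISub   (i j l : nat)   (* R_i := R_j - R_l, truncated at 0 *)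
| IHalf  (i j : nat)     (* R_i := floor (R_j / 2) *)
| ILoad  (i j : nat)     (* R_i := R_(R_j) *)
| IStore (i j : nat)     (* R_(R_i) := R_j *)
| IRead  (i j : nat)     (* R_i := entry number R_j of the input, 0 if none *)
| IJump  (a : nat)       (* go to instruction a *)
| IJzero (i a : nat).    (* go to instruction a if R_i = 0 *)

Definition program := seq instr.

(* Program counter and register contents. *)
Definition config := (nat * (nat -> nat))%type.

Definition upd (R : nat -> nat) (i x : nat) : nat -> nat :=
  fun j => if j == i then x else R j.

Definition exec (input : seq nat) (ins : instr) (c : config) : config :=
  let: (pc, R) := c in
  match ins with
  | IConst i x => (pc.+1, upd R i x)
  | IAdd i j l => (pc.+1, upd R i (R j + R l))
  | ISub i j l => (pc.+1, upd R i (R j - R l))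
  | IHalf i j  => (pc.+1, upd R i (R j)./2)
  | ILoad i j  => (pc.+1, upd R i (R (R j)))
  | IStore i j => (pc.+1, upd R (R i) (R j))
  | IRead i j  => (pc.+1, upd R i (nth 0 input (R j)))
  | IJump a    => (a, R)
  | IJzero i a => (if R i == 0 then a else pc.+1, R)
  end.

(* The machine has halted once the program counter leaves the program. *)
Definition halted (P : program) (c : config) : bool := size P <= c.1.

Definition step (P : program) (input : seq nat) (c : config) : config :=
  if onth P c.1 is Some ins then exec input ins c else c.

Definition run (P : program) (input : seq nat) (t : nat) : config :=
  iter t (step P input) (0, fun=> 0).

(* On the given input, P halts after at most T steps, with R_0 = 1 if Q holds
   and R_0 = 0 otherwise. *)
Definition decides_within (P : program) (input : seq nat) (T : nat) (Q : Prop)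
    : Prop :=
  exists (t : nat) (answer : bool),
    [/\ t <= T, halted P (run P input t),
        (run P input t).2 0 = answer & answer <-> Q].

(* The instance (D, k): the order of D, then k, then the adjacency matrix of D
   row by row. *)
Definition encode (n : nat) (e : rel 'I_n) (k : nat) : seq nat :=
  [:: n, k & [seq nat_of_bool (e i j) | i <- enum 'I_n, j <- enum 'I_n]].

(* Main.v *)
(* If a broadcast of cost at most k exists, then n <= 2 k D^k, where
   D = max(1, d): a ball of radius r > 0 has at most (r + 1) D^r <= 2 r D^r
   vertices.  So the machine answers 0 when n > 2 k D^k.  Otherwise it
   enumerates all functions of cost at most k, coded as stars and bars by the
   numbers below 2^(n + k), and tests each of them in time O((k + 1) n^2) by k
   rounds of Bellman-Ford relaxation.  If d <= 1 then n <= 2 k, and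
   2^(n + k) (k + 1) <= 16^k = O(k^k); if d >= 2 then n + 2 k <= d^(4 k). *)

Require Import Defs.
From mathcomp Require Import all_boot zify.

Set Implicit Arguments.
Unset Strict Implicit.
Unset Printing Implicit Defensive.

(** * A structured language for the machine *)

(** The running time is a claim about raw jump code, so the program is written in a small structured
    language whose weakest-precondition rules carry a step budget along with the postcondition.
    Every loop counts one register down to 0, so its number of rounds is known on entry. Truncated
    subtraction replaces comparisons: [y + (x - y)] is a maximum and [1 - x] a zero test. Every bit
    sequence is made to decode to some function of cost at most [k], so an accepted code is always a
    genuine solution, and completeness only asks that each broadcast have some code. A radius is
    stored as [f v + (0 < f v)], so that 0 can mean unreached while 1 means reached with no arc left
    to travel. *)

Inductive cmd :=
| Block (s : seq instr)
| Seq (c1 c2 : cmd)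
| When (i : nat) (c : cmd)
| While (i : nat) (c : cmd).

Notation "c1 ;; c2" := (Seq c1 c2) (at level 61, right associativity).

Fixpoint csize (c : cmd) : nat :=
  match c with
  | Block s => size s
  | c1 ;; c2 => csize c1 + csize c2
  | When _ c => (csize c).+1
  | While _ c => (csize c).+2
  end.

(** Jump targets are absolute, so the code depends on the address [a] at which it will be loaded. *)
Fixpoint compile (a : nat) (c : cmd) : program :=
  match c with
  | Block s => s
  | c1 ;; c2 => compile a c1 ++ compile (a + csize c1) c2
  | When i c => IJzero i (a + (csize c).+1) :: compile a.+1 c
  | While i c =>
      IJzero i (a + (csize c).+2) :: compile a.+1 c ++ [:: IJump a]
  end.

Lemma size_compile c a : size (compile a c) = csize c.
Proof.
elim: c a => [s|c1 IH1 c2 IH2|i c IH|i c IH] a //=.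
- by rewrite size_cat IH1 IH2.
- by rewrite IH.
- by rewrite size_cat IH addn1.
Qed.

Definition loaded (P : program) (a : nat) (s : seq instr) : Prop :=
  forall i, i < size s -> onth P (a + i) = onth s i.

Lemma loaded_cat P a s1 s2 :
  loaded P a (s1 ++ s2) -> loaded P a s1 /\ loaded P (a + size s1) s2.
Proof.
move=> ld; split=> i lti.
  by rewrite ld ?size_cat ?ltn_addr // onth_cat lti.
by rewrite -addnA ld ?size_cat ?ltn_add2l // onth_cat ltnNge leq_addr /= addKn.
Qed.

Lemma loaded_cons P a ins s :
  loaded P a (ins :: s) -> onth P a = Some ins /\ loaded P a.+1 s.
Proof.
rewrite -cat1s => /loaded_cat[/(_ 0 isT)]; rewrite addn0 => -> /=.
by rewrite addn1.
Qed.

Section WeakestPrecondition.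
Variable input : seq nat.
Implicit Types (R : nat -> nat) (Q : (nat -> nat) -> Prop) (T : nat).

(** The step count and the final registers are chosen before [P] and [a], so a verified fragment
    behaves alike wherever it is loaded; control leaves it exactly at its end. *)
Definition wp c T Q R : Prop :=
  exists t R', [/\ t <= T, Q R' & forall P a, loaded P a (compile a c) ->
    iter t (step P input) (a, R) = (a + csize c, R')].

Lemma wp_mono c T T' Q Q' R :
  T <= T' -> (forall R', Q R' -> Q' R') -> wp c T Q R -> wp c T' Q' R.
Proof.
move=> leT QQ' [t [R' [let_ QR' run_]]]; exists t, R'.
by split; [exact: leq_trans leT | exact: QQ' |].
Qed.

Definition straight (ins : instr) : bool :=
  match ins with IJump _ | IJzero _ _ => false | _ => true end.

Definition effect (R : nat -> nat) (ins : instr) : nat -> nat :=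
  (exec input ins (0, R)).2.

Lemma wp_block s T Q R :
  all straight s -> size s <= T -> Q (foldl effect R s) -> wp (Block s) T Q R.
Proof.
move=> strs leT QR; exists (size s), (foldl effect R s); split=> // P a /=.
elim: s R a strs {leT QR} => [|ins s IH] R a /=; first by rewrite addn0.
case/andP=> str_ins strs /loaded_cons[fetch ld].
rewrite -addSnnS -(IH _ _ strs ld) -iterS iterSr.
by rewrite {2}/step fetch; case: ins str_ins {fetch}.
Qed.

Lemma wp_seq T1 c1 c2 T Q R :
  T1 <= T -> wp c1 T1 (wp c2 (T - T1) Q) R -> wp (c1 ;; c2) T Q R.
Proof.
move=> leT1 [t1 [R1 [le1 [t2 [R2 [le2 QR2 run2]]] run1]]].
exists (t2 + t1), R2; split=> // [|P a /= /loaded_cat[]]; first by lia.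
rewrite size_compile => ld1 ld2.
by rewrite iterD run1 // run2 // addnA.
Qed.

Lemma wp_block_seq s c T Q R :
    all straight s -> size s <= T ->
  wp c (T - size s) Q (foldl effect R s) -> wp (Block s ;; c) T Q R.
Proof. by move=> strs leT wpc; apply: (wp_seq leT); exact: wp_block. Qed.

Lemma wp_when i c T Q R :
  (R i = 0 -> Q R) -> (R i <> 0 -> wp c T Q R) -> wp (When i c) T.+1 Q R.
Proof.
move=> Q0 Qc; case: (R i =P 0) => [Ri0|Ri].
  exists 1, R; split=> [//||P a /= /loaded_cons[fetch _]]; first exact: Q0.
  by rewrite /step fetch /= Ri0.
have [t [R' [let_ QR' run_]]] := Qc Ri.
exists t.+1, R'; split=> // P a /= /loaded_cons[fetch ld].
rewrite -iterS iterSr {2}/step fetch /=; case: eqP => // _.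
by rewrite run_ // addSnnS.
Qed.

(** The invariant is indexed by the value of the loop register, so [m] is also the number of rounds.
    Each round pays 2 extra steps, for the test and the jump back; the final test accounts for the
    strict inequality. *)
Lemma wp_while (I : nat -> (nat -> nat) -> Prop) m i c T T' Q R :
    (forall j R, I j R -> R i = j) ->
    (forall j R, I j.+1 R -> wp c T (I j) R) ->
    (forall R, I 0 R -> Q R) -> m * T.+2 < T' ->
  I m R -> wp (While i c) T' Q R.
Proof.
move=> Ii step_c IQ; elim: m R T' => [|m IH] R T' ltT' IR.
  exists 1, R; split=> [||P a /= /loaded_cons[fetch _]]; [lia | exact: IQ |].
  by rewrite /step fetch /= (Ii _ _ IR).
have [t [R1 [let_ IR1 run_]]] := step_c _ _ IR.
have [t' [R2 [let' QR2 run']]] := IH R1 (m * T.+2).+1 (ltnSn _) IR1.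
exists (t' + t.+2), R2; split=> [||P a ld]; [lia | done |].
have [fetch ld'] := loaded_cons ld; have [ldc ldj] := loaded_cat ld'.
have {ldj}[fetchj _] := loaded_cons ldj; rewrite size_compile in fetchj.
rewrite iterD iterS iterSr {4}/step fetch /= (Ii _ _ IR) /= run_ //.
by rewrite {2}/step fetchj /= run'.
Qed.

End WeakestPrecondition.

(** * Broadcasts and balls *)

Section Broadcasts.
Variables (V : finType) (e : rel V).
Implicit Types (u v t : V) (f : V -> nat).

(** Shortening a walk to a simple path never lengthens it, so arbitrary walks, which layers and
    relaxation produce, may replace the simple paths in [distance]. *)
Lemma dist_leP u v m :
  dist_le (distance e u v) m <->
  exists p, [/\ path e u p, last u p = v & size p <= m].
Proof.
rewrite /distance; split.
  case: {-}_ / idP => // uv /=; case: ex_minnP => r.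
  case/existsP=> p /and3P[pth _ /eqP lst] _ ler.
  by exists p; rewrite size_tuple.
case=> p [pth lst lem]; case: {-}_ / idP => [uv|[]] /=; last first.
  by apply/connectP; exists p.
case: ex_minnP => r _ /(_ (size (shorten u p))) min_r.
case/shortenP: pth lst min_r => q qth quniq sub_qp <- min_r.
apply: leq_trans (min_r _) _.
  by apply/existsP; exists (in_tuple q); rewrite qth quniq eqxx.
apply: leq_trans lem; apply: uniq_leq_size => //.
by case/andP: quniq.
Qed.

(** One entry for each walk of exactly [i] arcs from [t]: keeping multiplicities turns the size
    bound into a plain product. *)
Definition layer t (i : nat) : seq V :=
  iter i (fun s => flatten [seq enum [pred w | e u w] | u <- s]) [:: t].

Lemma mem_layer t p : path e t p -> last t p \in layer t (size p).
Proof.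
elim/last_ind: p => [|p v IH]; first by rewrite mem_seq1.
rewrite rcons_path last_rcons size_rcons => /andP[pth arc].
apply/flattenP; exists (enum [pred w | e (last t p) w]).
  by apply/mapP; exists (last t p) => //; exact: IH.
by rewrite mem_enum inE.
Qed.

Variable D : nat.
Hypothesis D_gt0 : 0 < D.
Hypothesis leD : max_outdegree e <= D.

Lemma size_layer t i : size (layer t i) <= D ^ i.
Proof.
elim: i => [//|i IH]; rewrite expnSr /=.
apply: leq_trans (leq_mul IH (leqnn D)).
elim: (layer t i) => [//|u s IHs] /=; rewrite size_cat mulSn leq_add //.
by rewrite -cardE (leq_trans _ leD) // /max_outdegree (leq_bigmax u).
Qed.

Definition ball t r : seq V := flatten [seq layer t i | i <- iota 0 r.+1].

Lemma mem_ball t r p : path e t p -> size p <= r -> last t p \in ball t r.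
Proof.
move=> pth ler; apply/flattenP; exists (layer t (size p)); last exact: mem_layer.
by apply/mapP; exists (size p) => //; rewrite mem_iota.
Qed.

Lemma size_ball t r : size (ball t r) <= r.+1 * D ^ r.
Proof.
rewrite /ball -{2}[r.+1](size_iota 0).
have: all (geq r) (iota 0 r.+1) by apply/allP => i; rewrite mem_iota.
elim: (iota _ _) => [//|i s IH] /= /andP[lei les].
rewrite size_cat mulSn leq_add ?IH //.
exact: leq_trans (size_layer _ _) (leq_pexp2l D_gt0 lei).
Qed.

(** Each covering ball is charged [2 * f t * D ^ k]: only the exponent is relaxed from [f t] to [k],
    so the sum over [t] stays linear in the cost. *)
Lemma order_le_broadcast f k :
  dominating_broadcast e f -> cost f <= k -> #|V| <= 2 * k * D ^ k.
Proof.
move=> dom lek.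
pose s := flatten [seq if 0 < f t then ball t (f t) else [::] | t <- enum V].
have sub : V \subset s.
  apply/subsetP=> v _; have [t [ft /dist_leP[p [pth <- lep]]]] := dom v.
  apply/flattenP; exists (ball t (f t)); last exact: mem_ball.
  by apply/mapP; exists t; rewrite ?mem_enum // ft.
apply: leq_trans (subset_leq_card sub) _; apply: leq_trans (card_size s) _.
apply: leq_trans (_ : 2 * cost f * D ^ k <= _); last first.
  by rewrite leq_mul2r leq_mul2l lek !orbT.
have le_fk t : f t <= k by rewrite (leq_trans _ lek) // /cost (bigD1 t) //= leq_addr.
rewrite /cost -[\sum_(v : V) _]big_enum /= {sub}/s.
elim: (enum V) => [|t r IH] /=; first by rewrite big_nil.
rewrite size_cat big_cons mulnDr mulnDl leq_add //.
case: posnP => [->//|ft]; apply: leq_trans (size_ball _ _) _.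
by rewrite leq_mul ?leq_pexp2l //; lia.
Qed.

End Broadcasts.

(** * Coding of broadcasts *)

(** The least significant bit comes first, so halving a number drops the head of the sequence. *)
Definition of_bits (s : bitseq) : nat :=
  foldr (fun (b : bool) m => b + m.*2) 0 s.

Lemma of_bits_lt s : of_bits s < 2 ^ size s.
Proof. by elim: s => [//|b s IH] /=; rewrite expnS; case: b; lia. Qed.

Lemma of_bits_surj m N : N < 2 ^ m -> exists2 s, size s = m & N = of_bits s.
Proof.
elim: m N => [|m IH] N ltN; first by exists [::] => //=; rewrite expn0 in ltN; lia.
have [|s <- def_s] := IH N./2; first by rewrite expnS in ltN; lia.
by exists (odd N :: s) => //=; rewrite -def_s odd_double_half.
Qed.

Lemma of_bits_inj s s' : size s = size s' -> of_bits s = of_bits s' -> s = s'.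
Proof.
elim: s s' => [|b s IH] [|b' s'] //= [eqsz] eqs.
by congr (_ :: _);
  [|apply: IH => //]; case: b b' eqs => [] []; lia.
Qed.

(* The state consists of the remaining budget, the current vertex, and the map
   [v |-> f v + (0 < f v)] for the function [f] built so far. *)
Definition decode_step (st : nat * nat * (nat -> nat)) (b : bool) :=
  let: (c, p, h) := st in
  let b' := b && (0 < c) in
  (c - b', p + ~~ b', upd h p (h p + b' + (b' - h p))).

Definition decode st (s : bitseq) := foldl decode_step st s.

(** A true bit puts one unit on the current vertex, a false bit moves on, and a true bit with no
    budget left counts as false. The first unit on a vertex raises [h] by 2, so the value 1 never
    occurs and [.-1] recovers [f]. *)
Lemma decode_sound n k h s :
    (forall i, i < n -> h i = 0) ->
    let: (_, _, h') := decode (k, 0, h) s in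
    (forall i, i < n -> h' i <> 1) /\ \sum_(i < n) (h' i).-1 <= k.
Proof.
move=> h0; pose inv (st : nat * nat * (nat -> nat)) :=
  (forall i, i < n -> st.2 i <> 1) /\ \sum_(i < n) (st.2 i).-1 + st.1.1 <= k.
suff: inv (decode (k, 0, h) s).
  by case: decode => [[c p] h'] [? le]; split=> //; move: le => /=; lia.
have: inv (k, 0, h).
  by split=> [i ltin|] /=; [rewrite h0 | rewrite big1 // => i _; rewrite h0].
elim: s (k, 0, h) => [//|b s IH] [[c p] g] [inv1 inv2]; apply: IH.
rewrite /= in inv1 inv2 *; split=> /= [i ltin|].
  rewrite /upd; case: eqP => [eip|_]; [rewrite eip in ltin | exact: inv1].
  case: (g p) (inv1 p ltin) => [|[|m]]; case: b; case: c {inv2} => [|c] //=; lia.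
have [ltpn|lenp] := ltnP p n; last first.
  rewrite (eq_bigr (fun i : 'I_n => (g i).-1)); first by case: b; lia.
  by move=> i _; rewrite /upd; case: eqP => // eip; have := ltn_ord i; lia.
rewrite (bigD1 (Ordinal ltpn)) //= in inv2.
rewrite (bigD1 (Ordinal ltpn)) //= {1}/upd eqxx.
rewrite (eq_bigr (fun i : 'I_n => (g i).-1)); last first.
  by move=> i ne; rewrite /upd -[p]/(val (Ordinal ltpn)) val_eqE (negbTE ne).
have := inv1 _ ltpn.
by case: (g p) inv2 => [|[|m]]; case: b; case: c => [|c] //=; lia.
Qed.

Definition radius_code (r : nat) : bitseq := nseq r true ++ [:: false].

Lemma decode_radius r c p h s : r <= c -> h p = 0 ->
  exists2 h', decode (c, p, h) (radius_code r ++ s) = decode (c - r, p.+1, h') s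
    & forall i, h' i = if i == p then r + (0 < r) else h i.
Proof.
move=> lerc hp0.
(* The induction on [r] passes through states in which [m] units already lie on [p]. *)
suff gen m : m + r <= c + m -> h p = m + (0 < m) ->
  exists2 h', decode (c, p, h) (radius_code r ++ s) = decode (c - r, p.+1, h') s
    & forall i, h' i = if i == p then m + r + (0 < m + r) else h i.
  by apply: (gen 0); lia.
elim: r c h m {lerc hp0} => [|r IH] c h m lerc hp /=.
  exists (upd h p (h p + 0 + (0 - h p))); first by rewrite subn0 addn1.
  by move=> i; rewrite /upd hp; case: eqP => //; lia.
have cgt0 : 0 < c by lia.
set h1 := upd h p (h p + (true && (0 < c)) + ((true && (0 < c)) - h p)).
have [||h' eqh h'E] := IH c.-1 h1 m.+1; first by lia.
  by rewrite /h1 /upd eqxx cgt0 hp; lia.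
exists h'; last by move=> i; rewrite h'E /h1 /upd; case: eqP => //; lia.
have -> : c - r.+1 = c.-1 - r by lia.
by rewrite -eqh /decode /= cgt0 /= addn0 subn1 /h1 cgt0.
Qed.

(** Radii in unary, each closed by a false bit, take [n] bits plus the cost; padding with false bits
    only moves the pointer further beyond the vertices. The code is chosen before [h], about which
    nothing is known from [n] on. *)
Lemma decode_complete n k (f : nat -> nat) :
  \sum_(i < n) f i <= k ->
  exists2 s, size s = n + k & forall h, (forall i, i < n -> h i = 0) ->
    forall i, i < n -> (decode (k, 0, h) s).2 i = f i + (0 < f i).
Proof.
move=> lek; pose code m j := flatten [seq radius_code (f i) | i <- iota j m].
have size_code m j : size (code m j) = m + \sum_(j <= i < j + m) f i.
  elim: m j => [|m IH] j; first by rewrite addn0 big_geq.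
  rewrite /code /= size_cat -/(code m j.+1) IH [in RHS]big_ltn; last by lia.
  by rewrite /radius_code size_cat size_nseq /= addSnnS; lia.
exists (code n 0 ++ nseq (k - \sum_(i < n) f i) false).
  by rewrite size_cat size_code add0n big_mkord size_nseq; lia.
move=> h h0.
have gen m j c g tl : j + m = n -> \sum_(j <= i < n) f i <= c ->
    (forall i, i < j -> g i = f i + (0 < f i)) ->
    (forall i, j <= i < n -> g i = 0) ->
  exists c' p' h', [/\
    decode (c, j, g) (code m j ++ tl) = decode (c', p', h') tl,
    n <= p' & forall i, i < n -> h' i = f i + (0 < f i)].
  elim: m j c g => [|m IH] j c g jm lec gE g0.
    by exists c, j, g; split=> // [|i lti]; [lia | apply: gE; lia].
  rewrite big_ltn in lec; last by lia.
  have [||g' eqg g'E] := @decode_radius (f j) c j g (code m j.+1 ++ tl); first by lia.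
    by apply: g0; lia.
  have [|||i lti|c' [p' [h' [eqh lenp h'E]]]] := IH j.+1 (c - f j) g'; try lia.
  - by move=> i lti; rewrite g'E; case: eqP => [->//|ne]; apply: gE; lia.
  - by rewrite g'E; case: eqP => [|ne]; [lia | apply: g0; lia].
  exists c', p', h'; split=> //.
  by rewrite /code /= -catA eqg.
set tl := nseq _ false.
have [|||i /andP[_ /h0]|c [p [h' [-> lenp h'E]]]] //= := gen n 0 k h tl.
  by rewrite big_mkord.
move=> i lti; rewrite -h'E // {}/tl.
elim: (k - _) c p h' lenp {h'E} => [//|m IH] c p h' lenp /=.
rewrite IH; last by lia.
by rewrite /upd; case: eqP => //; lia.
Qed.
Lemma nth_allpairs (S T : Type) (f : S -> T -> nat) x0 y0 s t i j :
    i < size s -> j < size t ->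
  nth 0 (allpairs f s t) (i * size t + j) = f (nth x0 s i) (nth y0 t j).
Proof.
elim: s i => [//|x s IH] [|i] /= lti ltj; rewrite nth_cat size_map.
  by rewrite ltj (nth_map y0).
by rewrite mulSn -addnA ltnNge leq_addr /= addKn IH.
Qed.

Lemma nth_encode n (e : rel 'I_n) k (v w : 'I_n) :
  nth 0 (encode e k) (2 + (v * n + w)) = e v w.
Proof.
have := @nth_allpairs _ _ (fun i j => nat_of_bool (e i j)) v w (enum 'I_n)
  (enum 'I_n) v w.
by rewrite size_enum_ord !nth_ord_enum => <-.
Qed.

(** * Relaxation *)

Section Residuals.
Variables (n : nat) (e : rel 'I_n) (f : 'I_n -> nat).
Implicit Types (h : nat -> nat) (v w t : 'I_n).

(* A residual [h v > 0] says that a broadcast reaches [v] and could still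
   travel [h v - 1] arcs. *)
Definition residual_sound h : Prop :=
  forall v, 0 < h v -> exists t p,
    [/\ 0 < f t, path e t p, last t p = v & size p + h v <= (f t).+1].

(** For walks longer than [f t] the inequality is trivial, so nothing is left to gain once [j]
    reaches the largest radius. *)
Definition residual_complete h (j : nat) : Prop :=
  forall t p, 0 < f t -> path e t p -> size p <= j ->
    (f t).+1 <= h (last t p) + size p.

Lemma residual_init h : (forall v, h v = f v + (0 < f v)) ->
  residual_sound h /\ residual_complete h 0.
Proof.
move=> hE; split=> [v|t [|//] ft _ _].
  by rewrite hE => hv; exists v, [::]; split=> //=; lia.
by rewrite /= hE ft; lia.
Qed.

(** The new value at [w] is the maximum of [h w] and [h v - 1]; if the latter wins, the walk
    reaching [v] is extended by the arc to [w]. *)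
Lemma residual_relax h h' v w : e v w -> residual_sound h ->
    (forall u : 'I_n, h' u = upd h w (h w + (h v - 1 - h w)) u) ->
  residual_sound h'.
Proof.
move=> arc snd h'E u; rewrite h'E /upd; case: eqP => [/ord_inj->|_]; last exact: snd.
move=> pos; have [hw|hw] := leqP (h v - 1) (h w).
  by have [|t [p [? ? ? ?]]] := snd w; [lia | exists t, p; split=> //; lia].
have [|t [p [ft pth lst le]]] := snd v; first by lia.
exists t, (rcons p w); rewrite rcons_path pth lst arc last_rcons size_rcons.
by split=> //; lia.
Qed.

(** Pairs are scanned row by row, and [q] of them are done. Updates happen in place, so [h v] may
    already exceed its value [h0 v] at the start of the round; only [h0 v] is guaranteed to have
    been propagated. *)
Definition relaxed h0 h (q : nat) : Prop :=
  (forall v, h0 v <= h v) /\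
  (forall v w, v * n + w < q -> e v w -> h0 v <= (h w).+1).

Lemma relaxed_step h0 h h' v w :
    relaxed h0 h (v * n + w) -> (forall u : 'I_n, h u <= h' u) ->
    (e v w -> h v <= (h' w).+1) ->
  relaxed h0 h' (v * n + w).+1.
Proof.
move=> [mono rel_] le_h arc_le; split=> [u|v' w'].
  exact: leq_trans (mono u) (le_h u).
rewrite ltnS leq_eqVlt => /orP[/eqP eq_vw arc|lt_vw arc]; last first.
  by apply: leq_trans (rel_ v' w' lt_vw arc) _; rewrite ltnS.
have n_gt0 : 0 < n by apply: leq_ltn_trans (ltn_ord v).
have ev : v' = v.
  apply/val_inj; move/(congr1 (fun q => q %/ n)): eq_vw.
  by rewrite !divnMDl // !divn_small // !addn0.
have ew : w' = w.
  apply/val_inj; move/(congr1 (fun q => q %% n)): eq_vw.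
  by rewrite !modnMDl !modn_small.
by rewrite ev ew in arc *; apply: leq_trans (mono v) (arc_le arc).
Qed.

(** The walk without its last arc is covered by [h0], and the last arc was relaxed during the round:
    each round gains one arc. *)
Lemma relaxed_complete h0 h j :
  relaxed h0 h (n * n) -> residual_complete h0 j -> residual_complete h j.+1.
Proof.
move=> [mono rel_] cpl t p; elim/last_ind: p => [|p w _] ft pth lep.
  by have := cpl t [::] ft isT isT; have := mono t; rewrite /=; lia.
rewrite rcons_path in pth; case/andP: pth => pth arc.
rewrite size_rcons last_rcons in lep *.
have := cpl t p ft pth lep; have := rel_ _ _ _ arc.
have lt_vw : last t p * n + w < n * n.
  by have := ltn_ord (last t p); have := ltn_ord w; nia.
by move=> /(_ lt_vw); lia.
Qed.

(** A broadcast from [t] travels at most [f t <= k] arcs, which is why [k] rounds are enough. *)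
Lemma residual_covered h k v :
    (forall t, f t <= k) -> residual_sound h -> residual_complete h k ->
  0 < h v <-> exists t, 0 < f t /\ dist_le (distance e t v) (f t).
Proof.
move=> fk snd cpl; split=> [hv|[t [ft]]].
  have [t [p [ft pth lst leh]]] := snd v hv.
  exists t; split=> //; apply/dist_leP; exists p; split=> //.
  by rewrite -ltnS; apply: leq_trans leh; rewrite -addn1 leq_add2l.
case/dist_leP=> p [pth <- lep].
have := cpl t p ft pth (leq_trans lep (fk t)).
by apply: contraTltn; rewrite leqn0 => /eqP->; rewrite -leqNgt.
Qed.

End Residuals.

(** * Arithmetic of the running time *)

(** If [k <= c] then [c ^ k <= c ^ c], otherwise [c ^ k <= k ^ k]. At [k = 0] the convention
    [0 ^ 0 = 1] keeps the product positive. *)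
Lemma expn_le_self c k : 0 < c -> c ^ k <= c ^ c * k ^ k.
Proof.
move=> c_gt0; have [lekc|ltck] := leqP k c.
  apply: leq_trans (leq_pexp2l c_gt0 lekc) _.
  by rewrite leq_pmulr //; case: k {lekc} => // k; rewrite expn_gt0.
apply: leq_trans (leq_pmull _ _); last by rewrite expn_gt0 c_gt0.
have k_gt0 : 0 < k by exact: leq_ltn_trans ltck.
by rewrite leq_exp2r // ltnW.
Qed.

(** The second [k] in the exponent pays for the factor [k + 1 <= 2 ^ k] spent on testing one
    candidate. *)
Lemma enumeration_bound : exists C, forall n k d,
  0 < n -> n <= 2 * k * maxn 1 d ^ k ->
  2 ^ (n + k + k) <= C * k ^ k * 2 ^ (d ^ (4 * k)).
Proof.
(* The constant is 16, kept abstract so that [16 ^ 16] is never evaluated. *)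
have [c16 [c16_gt0 c16E]] : exists c, 0 < c /\ forall k, 2 ^ (4 * k) = c ^ k.
  by exists (2 ^ 4); split=> // k; rewrite expnM.
exists (c16 ^ c16) => n k d n_gt0 len.
have kk_gt0 : 0 < k ^ k by case: (k) => // k'; rewrite expn_gt0.
have k_gt0 : 0 < k by case: k len {kk_gt0} => //; lia.
have [led1|ltd1] := leqP d 1.
  rewrite (maxn_idPl led1) exp1n in len.
  apply: leq_trans (leq_pmulr _ _); last by rewrite expn_gt0.
  apply: leq_trans (expn_le_self k c16_gt0); rewrite -c16E leq_exp2l //; lia.
apply: leq_trans (leq_pmull _ _); last by rewrite muln_gt0 expn_gt0 c16_gt0.
rewrite leq_exp2l //; rewrite (maxn_idPr (ltnW ltd1)) in len.
have dk_gt0 : 0 < d ^ k by rewrite expn_gt0; lia.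
(* Source of the exponent [4 * k]: [n + 2 * k <= 4 * k * d ^ k <= d ^ (3 * k) * d ^ k]. *)
have : 4 * k <= d ^ (3 * k).
  apply: leq_trans (_ : 2 ^ (3 * k) <= _); last by rewrite leq_exp2r //; lia.
  apply: leq_trans (_ : 2 ^ (2 + k) <= _); last by rewrite leq_exp2l //; lia.
  by rewrite expnD; have := ltn_expl k (isT : 1 < 2); lia.
have -> : 4 * k = 3 * k + k by lia.
by rewrite expnD; move: (d ^ (3 * k)) => X leX; nia.
Qed.

(** * The program *)

Notation rans := 0 (only parsing).
Notation rone := 1 (only parsing).
Notation rn := 2 (only parsing).
Notation rk := 3 (only parsing).
Notation ridx := 4 (only parsing).
Notation ri := 5 (only parsing).
Notation rj := 6 (only parsing).
Notation racc := 7 (only parsing).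
Notation rt := 8 (only parsing).
Notation rx := 9 (only parsing).
Notation ry := 10 (only parsing).
Notation rD := 11 (only parsing).
Notation rw := 12 (only parsing).
Notation rm := 13 (only parsing).
Notation rM := 14 (only parsing).
Notation rN := 15 (only parsing).
Notation rc := 16 (only parsing).
Notation rp := 17 (only parsing).
Notation rq := 18 (only parsing).
Notation rr := 19 (only parsing).
Notation rok := 20 (only parsing).
Notation rb := 21 (only parsing).
Notation ru := 22 (only parsing).
Notation rz := 23 (only parsing).
(* All registers from [base] on form an array indexed by the vertices. *)
Notation base := 24 (only parsing).

(** Register [rz] is never written and so holds 0; adding it to a register makes a copy. *)
Definition clear_code : cmd :=
  Block [:: IConst rp base; IAdd ri rn rz] ;;
  While ri (Block [:: IStore rp rz; IAdd rp rp rone; ISub ri ri rone]).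

(** With [rt] half of [rN], [rN - rt - rt] is the low bit [b], and [b - (1 - c)] is its conjunction
    with [0 < c]. The pointer may run past the vertices; the array comes last, so such writes do no
    harm. *)
Definition decode_code : cmd :=
  Block [:: IAdd rN rM rz; IAdd rc rk rz; IConst rp base; IAdd ri rm rz] ;;
  While ri (
    Block [:: IHalf rt rN; ISub rb rN rt; ISub rb rb rt; IAdd rN rt rz;
              ISub ru rone rc; ISub rb rb ru] ;;
    Block [:: ILoad rx rp; ISub ru rb rx; IAdd rx rx rb; IAdd rx rx ru;
              IStore rp rx] ;;
    Block [:: ISub rc rc rb; ISub ru rone rb; IAdd rp rp ru; ISub ri ri rone]).

Definition relax_code : cmd :=
  Block [:: IRead rt ridx] ;;
  When rt (Block [:: ILoad rx rp; ISub rx rx rone; ILoad ry rq; ISub rx rx ry;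
                     IAdd ry ry rx; IStore rq ry]) ;;
  Block [:: IAdd rq rq rone; IAdd ridx ridx rone; ISub rj rj rone].

Definition relax_row_code : cmd :=
  Block [:: IConst rq base; IAdd rj rn rz] ;;
  While rj relax_code ;;
  Block [:: IAdd rp rp rone; ISub ri ri rone].

Definition relax_round_code : cmd :=
  Block [:: IConst ridx 2; IConst rp base; IAdd ri rn rz] ;;
  While ri relax_row_code ;;
  Block [:: ISub rr rr rone].

Definition relax_all_code : cmd :=
  Block [:: IAdd rr rk rz] ;; While rr relax_round_code.

Definition check_code : cmd :=
  Block [:: IConst rok 1; IConst rp base; IAdd ri rn rz] ;;
  While ri (Block [:: ILoad rx rp; ISub ru rone rx; ISub rok rok ru;
                      IAdd rp rp rone; ISub ri ri rone]).

(** Since [rM] is decremented first, the codes tried run from [2 ^ (n + k) - 1] down to 0. The last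
    block is a disjunction of answer bits. *)
Definition try_code : cmd :=
  Block [:: ISub rM rM rone] ;; clear_code ;; decode_code ;; relax_all_code ;;
  check_code ;; Block [:: ISub ru rok rans; IAdd rans rans ru].

Definition enumerate_code : cmd :=
  Block [:: IConst rM 1; IAdd rm rn rk; IAdd ri rm rz] ;;
  While ri (Block [:: IAdd rM rM rM; ISub ri ri rone]) ;;
  While rM try_code.

Definition outdegree_row_code : cmd :=
  Block [:: IConst racc 0; IAdd rj rn rz] ;;
  While rj (Block [:: IRead rt ridx; IAdd racc racc rt; IAdd ridx ridx rone;
                      ISub rj rj rone]) ;;
  Block [:: ISub rt racc rD; IAdd rD rD rt; ISub ri ri rone].

(** Multiplies [rw] by [rD] through [rD] additions, which is affordable because the branching factor
    is at most [n]. *)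
Definition power_code : cmd :=
  Block [:: IConst racc 0; IAdd rj rD rz] ;;
  While rj (Block [:: IAdd racc racc rw; ISub rj rj rone]) ;;
  Block [:: IAdd rw racc rz; ISub ri ri rone].

(** [rD] starts at 1 to yield the maximum with 1, and [ridx] at 2 because the matrix follows [n] and
    [k]. [rw] grows from [2 * k] to the threshold, and [rw + 1 - n] vanishes exactly when [n]
    exceeds it. *)
Definition main_code : cmd :=
  Block [:: IConst rone 1; IRead rn rz; IRead rk rone; IConst rD 1;
            IConst ridx 2; IAdd ri rn rz] ;;
  While ri outdegree_row_code ;;
  Block [:: IAdd rw rk rk; IAdd ri rk rz] ;;
  While ri power_code ;;
  Block [:: IAdd rt rw rone; ISub rt rt rn] ;;
  When rt enumerate_code.

(** * Correctness and running time *)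

Ltac reg_eq :=
  repeat match goal with
  | |- context [if ?a == ?b then _ else _] =>
      first [ rewrite (_ : (a == b) = false); [ | by apply/eqP; lia ]
            | rewrite (_ : (a == b) = true); [ | by apply/eqP; lia ] ]
  end.
Ltac exec_block := rewrite /effect /= /upd /=.

Section Verification.
Variables (n k : nat) (e : rel 'I_n).
Notation input := (encode e k).
Implicit Types (R : nat -> nat).

Definition env (M a : nat) R : Prop :=
  [/\ [/\ R rz = 0, R rone = 1, R rn = n & R rk = k],
      R rm = n + k, R rM = M & R rans = a].

Lemma wp_clear M a R : env M a R ->
  wp input clear_code (5 * n + 3)
    (fun R' => env M a R' /\ forall i, i < n -> R' (base + i) = 0) R.
Proof.
case=> [[z1 z2 z3 z4] z5 z6 z7]; apply: wp_block_seq => //; first by rewrite /=; lia.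
pose I j R' := [/\ env M a R', R' ri = j & exists v,
  [/\ v + j = n, R' rp = base + v & forall i, i < v -> R' (base + i) = 0]].
apply: (@wp_while _ I n _ _ 3) => [j R'||R'||]; first by case.
- move=> j R' [[[y1 y2 y3 y4] y5 y6 y7] y8 [v [vj yp y0]]].
  apply: wp_block => //; exec_block; rewrite yp y1 y2 y8.
  split; first by split; [split | | |] => //=; reg_eq.
    by reg_eq; lia.
  exists v.+1; split; [lia | by reg_eq; lia | move=> i lti].
  by reg_eq; case: eqP => // ?; apply: y0; lia.
- case=> Renv _ [v [vj _ R0]]; split=> // i lti; apply: R0; lia.
- by rewrite /=; lia.
rewrite /I /env; exec_block; split; [by split; first split | by lia |].
by exists 0; split; lia.
Qed.

Ltac env_tac := split; [split | | | ]; rewrite /=; reg_eq; solve [assumption | lia].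

Lemma wp_decode a s R : size s = n + k -> env (of_bits s) a R ->
  wp input decode_code (17 * (n + k) + 5)
    (fun R' => env (of_bits s) a R' /\ forall i,
      R' (base + i) = (decode (k, 0, fun i => R (base + i)) s).2 i) R.
Proof.
move=> szs [[z1 z2 z3 z4] z5 z6 z7].
apply: wp_block_seq => //; first by rewrite /=; lia.
(* The unread bits [s'], run from the current state, lead to the same final state as all of [s] from
   the initial one. *)
pose I j R' := [/\ env (of_bits s) a R', R' ri = j & exists s' c p h,
  [/\ size s' = j, R' rN = of_bits s', R' rc = c & R' rp = base + p] /\
  (forall i, R' (base + i) = h i) /\
  decode (c, p, h) s' = decode (k, 0, fun i => R (base + i)) s].
apply: (@wp_while _ I (n + k) _ _ 15) => [j R'||R'||]; first by case.
- move=> j R' [[[y1 y2 y3 y4] y5 y6 y7] y8 [s' [c [p [h [[]]]]]]].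
  case: s' => // b s' [szs'] yN yc yp [yh dec].
  pose b' := b && (0 < c).
  pose mid g R2 := [/\ env (of_bits s) a R2, [/\ R2 ri = j.+1, R2 rN = of_bits s',
    R2 rb = b', R2 rc = c & R2 rp = base + p] & forall i, R2 (base + i) = g i].
  apply: (wp_seq (T1 := 6)) => //; apply: (@wp_mono _ _ 6 _ (mid h)) => // [R1 mid1|].
    apply: (wp_seq (T1 := 5)) => //; set h' := upd h p (h p + b' + (b' - h p)).
    apply: (@wp_mono _ _ 5 _ (mid h')) => // [R2 mid2|].
      case: mid2 => [[[x1 x2 x3 x4] x5 x6 x7] [xi xN xb xc xp] xh].
      apply: wp_block => //; exec_block; rewrite xp xc xb xi x2.
      split; [by env_tac | by rewrite /=; lia |].
      exists s', (c - b'), (p + ~~ b'), h'; split; last by split.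
      by split=> //=; case: (b'); rewrite /=; lia.
    case: mid1 => [[[x1 x2 x3 x4] x5 x6 x7] [xi xN xb xc xp] xh].
    apply: wp_block => //; exec_block; rewrite xp xb xh; reg_eq.
    split; [by env_tac | by split; reg_eq | move=> i].
    by rewrite /h' /upd; reg_eq; rewrite eqn_add2l; case: eqP.
  apply: wp_block => //.
  have halfN : (R' rN)./2 = of_bits s' by rewrite yN /= half_bit_double.
  have bitN : R' rN - of_bits s' - of_bits s' = b by rewrite yN /=; lia.
  have bE : b - (1 - c) = b'.
    by rewrite /b'; case: (b); case: (c) => [|[]].
  exec_block; rewrite y1 y2 yc halfN bitN bE addn0.
  by split; [env_tac | split | ].
- case=> Renv _ [s' [c [p [h [[s0 _ _ _] [hE]]]]]].
  by rewrite (size0nil s0) => <-.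
- by rewrite /=; lia.
rewrite /I /env; exec_block; split; [by env_tac | by rewrite /=; lia |].
by exists s, k, 0, (fun i => R (base + i)); rewrite z1 z4 z6 !addn0.
Qed.

Lemma wp_check M a R : env M a R ->
  wp input check_code (7 * n + 4)
    (fun R' => env M a R' /\ R' rok = all (fun i => 0 < R (base + i)) (iota 0 n))
    R.
Proof.
case=> [[z1 z2 z3 z4] z5 z6 z7]; apply: wp_block_seq => //; first by rewrite /=; lia.
pose I j R' := [/\ env M a R', R' ri = j & exists v,
  [/\ v + j = n, R' rp = base + v,
      R' rok = all (fun i => 0 < R (base + i)) (iota 0 v)
    & forall i, R' (base + i) = R (base + i)]].
apply: (@wp_while _ I n _ _ 5) => [j R'||R'||]; first by case.
- move=> j R' [[[y1 y2 y3 y4] y5 y6 y7] y8 [v [vj yp yok yh]]].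
  apply: wp_block => //; exec_block; rewrite yp y2 y8 yok yh.
  split; [by env_tac | by rewrite /=; lia |].
  exists v.+1; rewrite -(addn1 v) iotaD all_cat /= andbT add0n.
  split; [by lia | by rewrite /=; lia | | by []].
  by case: (all _ _); case: (R (base + v)) => [|[]].
- case=> Renv _ [v [vj _ Rok _]]; split=> //; rewrite Rok.
  by congr (nat_of_bool (all _ (iota 0 _))); lia.
- by rewrite /=; lia.
rewrite /I /env; exec_block; split; [by env_tac | by rewrite /=; lia |].
by exists 0; split; rewrite ?addn0.
Qed.

(** * Relaxation rounds on the array of residuals *)

Section Relaxation.
Variables (f : 'I_n -> nat) (M a : nat).

Definition relax_state (h0 : nat -> nat) r i q v R : Prop :=
  [/\ env M a R, [/\ R rr = r, R ri = i, R ridx = 2 + q & R rp = base + v],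
      residual_sound e f (fun u => R (base + u))
    & relaxed e h0 (fun u => R (base + u)) q].

Lemma wp_relax h0 r i j (v w : 'I_n) R :
    relax_state h0 r i (v * n + w) v R -> R rj = j.+1 -> R rq = base + w ->
  wp input relax_code 11 (fun R' =>
    [/\ relax_state h0 r i (v * n + w).+1 v R', R' rj = j
      & R' rq = base + w.+1]) R.
Proof.
move=> [[[z1 z2 z3 z4] z5 z6 z7] [Rr Ri Ridx Rp] snd rel_] Rj Rq.
apply: wp_block_seq => //; exec_block; rewrite Ridx nth_encode.
apply: (wp_seq (T1 := 7)) => //.
pose mid R' := [/\ env M a R',
      [/\ R' rr = r, R' ri = i, R' ridx = 2 + (v * n + w) & R' rp = base + v],
      R' rj = j.+1, R' rq = base + w &
      residual_sound e f (fun u => R' (base + u)) /\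
      relaxed e h0 (fun u => R' (base + u)) (v * n + w).+1].
have fin R' : mid R' -> wp input
    (Block [:: IAdd rq rq rone; IAdd ridx ridx rone; ISub rj rj rone])
    (11 - 1 - 7) (fun R' => [/\ relax_state h0 r i (v * n + w).+1 v R', R' rj = j
      & R' rq = base + w.+1]) R'.
  case=> [[[y1 y2 y3 y4] y5 y6 y7] [yr yi yidx yp] yj yq [ysnd yrel]].
  apply: wp_block => //; exec_block; rewrite yidx yj yq y2.
  split=> /=; [split=> /=; [by env_tac | split; lia | by [] | by []] | lia | lia].
apply: wp_mono (leqnn _) fin _; apply: wp_when => /= [e0|e1].
  split; [by env_tac | by [] | by [] | by [] |]; split; first exact: snd.
  apply: relaxed_step rel_ _ _ => //.
  by move: e0; case: (e v w).
have arc : e v w by case: (e v w) e1.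
apply: wp_block => //; exec_block; rewrite Rp Rq z2; reg_eq.
set x := R (base + w) + _.
have xE : x = R (base + w) + (R (base + v) - 1 - R (base + w)) by [].
split; [by env_tac | split; reg_eq; lia | by reg_eq; lia | by reg_eq; lia | split].
  apply: (residual_relax arc snd) => u; rewrite /upd; reg_eq.
  by rewrite eqn_add2l.
apply: relaxed_step rel_ _ _ => [u|_] /=; reg_eq; last by lia.
by rewrite eqn_add2l; case: eqP => [->|//]; rewrite xE leq_addr.
Qed.

Lemma wp_relax_row h0 r i (v : 'I_n) R :
    relax_state h0 r i.+1 (v * n) v R ->
  wp input relax_row_code (13 * n + 5) (relax_state h0 r i (v.+1 * n) v.+1) R.
Proof.
move=> [[[z1 z2 z3 z4] z5 z6 z7] [Rr Ri Ridx Rp] snd rel_].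
apply: wp_block_seq => //; first by rewrite /=; lia.
apply: (wp_seq (T1 := 13 * n + 1)) => /=; first by lia.
pose I j R' := R' rj = j /\ exists w, [/\ w + j = n, R' rq = base + w
  & relax_state h0 r i.+1 (v * n + w) v R'].
apply: (@wp_while _ I n _ _ 11) => [j R'|j R'|R'||]; first by case.
- case=> yj [w [wj yq st]]; have ltwn : w < n by lia.
  have := @wp_relax h0 r i.+1 j v (Ordinal ltwn) R' st yj yq.
  apply: wp_mono => // R2 [st2 j2 q2]; split=> //; exists w.+1.
  by split=> //; [lia | rewrite addnS].
- case=> yj [w [wj yq [[[y1 y2 y3 y4] y5 y6 y7] [yr yi yidx yp] ysnd yrel]]].
  have qE : v * n + w = v.+1 * n by rewrite mulSn addnC; lia.
  rewrite qE in yidx yrel.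
  apply: wp_block => //; first by rewrite /=; lia.
  exec_block; rewrite /relax_state yp yi y2; split; [by env_tac | | by [] | by []].
  by split; rewrite /=; lia.
- by lia.
rewrite /I; exec_block; rewrite z1 z3 addn0; split=> //; exists 0; split=> //.
by rewrite addn0; split; [env_tac | split | |].
Qed.

Lemma wp_relax_round j r R :
    env M a R -> R rr = r.+1 ->
    residual_sound e f (fun u => R (base + u)) ->
    residual_complete e f (fun u => R (base + u)) j ->
  wp input relax_round_code (n * (13 * n + 7) + 5) (fun R' =>
    [/\ env M a R', R' rr = r, residual_sound e f (fun u => R' (base + u))
      & residual_complete e f (fun u => R' (base + u)) j.+1]) R.
Proof.
move=> [[z1 z2 z3 z4] z5 z6 z7] Rr snd cpl.
apply: wp_block_seq => //; first by rewrite /=; lia.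
apply: (wp_seq (T1 := n * (13 * n + 7) + 1)) => /=; first by lia.
set h0 := fun u => R (base + u) in cpl *.
pose I i R' := exists v, v + i = n /\ relax_state h0 r.+1 i (v * n) v R'.
apply: (@wp_while _ I n _ _ (13 * n + 5)) => [i R'|i R'|R'||].
- by case=> v [_ []] _ [].
- case=> v [vi st]; have ltvn : v < n by lia.
  have := @wp_relax_row h0 r.+1 i (Ordinal ltvn) R' st.
  apply: wp_mono => // R2 st2; exists v.+1; split; [lia | exact: st2].
- case=> v [vi [[[y1 y2 y3 y4] y5 y6 y7] [yr yi yidx yp] ysnd yrel]].
  have vE : v = n by lia.
  rewrite vE in yrel.
  apply: wp_block => //; first by rewrite /=; lia.
  exec_block; split; [by env_tac | by lia | by [] |].
  by apply: (relaxed_complete _ cpl).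
- by lia.
exists 0; split=> //; rewrite /relax_state; exec_block.
by split; [env_tac | split; rewrite /=; lia | by [] | split].
Qed.

Lemma wp_relax_all R :
    env M a R -> (forall u : 'I_n, R (base + u) = f u + (0 < f u)) ->
  wp input relax_all_code (k * (n * (13 * n + 7) + 7) + 2) (fun R' =>
    [/\ env M a R', residual_sound e f (fun u => R' (base + u))
      & residual_complete e f (fun u => R' (base + u)) k]) R.
Proof.
move=> [[z1 z2 z3 z4] z5 z6 z7] init.
apply: wp_block_seq => //; first by rewrite /=; lia.
pose I r R' := exists j, [/\ j + r = k, R' rr = r, env M a R',
  residual_sound e f (fun u => R' (base + u))
  & residual_complete e f (fun u => R' (base + u)) j].
apply: (@wp_while _ I k _ _ (n * (13 * n + 7) + 5)) => [r R'|r R'|R'||].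
- by case=> j [].
- case=> j [jr yr yenv ysnd ycpl].
  have := wp_relax_round yenv yr ysnd ycpl.
  by apply: wp_mono => // R2 [? ? ? ?]; exists j.+1; split=> //; lia.
- by case=> j [jk _ ? ?]; rewrite addn0 in jk; rewrite jk.
- by rewrite /=; lia.
have [snd cpl] := @residual_init n e f (fun u => R (base + u)) init.
exists 0; rewrite /env; exec_block.
by split; [by [] | rewrite /=; lia | env_tac | by [] | by []].
Qed.

End Relaxation.

(** The array [h] is left arbitrary from [n] on, where earlier candidates may have written. *)
Definition is_code (N : nat) : Prop :=
  exists (s : bitseq) (f : 'I_n -> nat), [/\ size s = n + k, N = of_bits s,
    dominating_broadcast e f & forall h, (forall i, i < n -> h i = 0) ->
    forall i : 'I_n, (decode (k, 0, h) s).2 i = f i + (0 < f i)].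

Lemma is_code_exists : broadcast_domination e k ->
  exists2 N, is_code N & N < 2 ^ (n + k).
Proof.
case=> f [dom lek]; pose g i := if insub i is Some v then f v else 0.
have gE (v : 'I_n) : g v = f v by rewrite /g valK.
have [|s szs dec] := @decode_complete n k g.
  by under eq_bigr => i _ do rewrite gE.
exists (of_bits s); last by rewrite -szs of_bits_lt.
by exists s, f; split=> // h h0 i; rewrite dec // gE.
Qed.

Definition try_time : nat := 24 * (k.+1 * n.+1 ^ 2).

(** The two directions are asymmetric: any [M] in range decodes to a function of cost at most [k],
    so acceptance is always sound, while rejection is excluded only for the code of a dominating
    broadcast. *)
Lemma wp_try M (a : bool) R :
    M.+1 <= 2 ^ (n + k) -> env M.+1 a R ->
  wp input try_code try_time (fun R' => exists b : bool,
    [/\ env M (a || b) R', b -> broadcast_domination e k & is_code M -> b]) R.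
Proof.
move=> ltM [[z1 z2 z3 z4] z5 z6 z7].
(* The 24 in [try_time] is the coefficient of [k]: 17 from decoding and 7 from relaxation. All other
   monomials have slack. *)
have leT : 1 + (5 * n + 3) + (17 * (n + k) + 5) + (k * (n * (13 * n + 7) + 7) + 2)
    + (7 * n + 4) + 2 <= try_time.
    have -> : try_time = 24 * (k * (n * n) + 2 * (k * n) + k + n * n + 2 * n + 1).
      by rewrite /try_time -mulnn; lia.
    have -> : k * (n * (13 * n + 7) + 7) = 13 * (k * (n * n)) + 7 * (k * n) + 7 * k.
      by lia.
    by move: (k * (n * n)) (k * n) (n * n); lia.
have [s szs Ms] := of_bits_surj ltM.
apply: wp_block_seq => //.
apply: (wp_seq (T1 := 5 * n + 3)) => /=; first by lia.
apply: wp_mono (leqnn _) _ (wp_clear (M := M) (a := a) _); last first.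
  by rewrite /env; exec_block; env_tac.
move=> R1 [env1 R10]; apply: (wp_seq (T1 := 17 * (n + k) + 5)); first by lia.
rewrite Ms in env1 *.
apply: wp_mono (leqnn _) _ (wp_decode szs env1) => R2 [env2 R2E].
have [ne1 le_cost] : (forall i, i < n -> R2 (base + i) <> 1) /\
    \sum_(i < n) (R2 (base + i)).-1 <= k.
  have := @decode_sound n k _ s R10; case: decode R2E => [[c p] h] /= R2E [h1 hk].
  split=> [i lti|]; first by rewrite R2E; exact: h1.
  by under eq_bigr => i _ do rewrite R2E.
pose f (i : 'I_n) := (R2 (base + i)).-1.
apply: (wp_seq (T1 := k * (n * (13 * n + 7) + 7) + 2)); first by lia.
apply: wp_mono (leqnn _) _ (wp_relax_all (f := f) env2 _) =>
  [R3 [env3 snd cpl]|u]; last first.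
  by rewrite /f; have := ne1 u (ltn_ord u); case: (R2 _) => [|[|m]] //= _; rewrite addn1.
apply: (wp_seq (T1 := 7 * n + 4)); first by lia.
apply: wp_mono (leqnn _) _ (wp_check env3) => R4 [[[y1 y2 y3 y4] y5 y6 y7] R4ok].
have fk u : f u <= k.
  by apply: leq_trans le_cost; rewrite (bigD1 u) //= leq_addr.
have okP : all (fun i => 0 < R3 (base + i)) (iota 0 n) <-> dominating_broadcast e f.
  split=> [/allP pos v|dom]; last first.
    apply/allP => i; rewrite mem_iota => lti.
    by have /(residual_covered (Ordinal lti) fk snd cpl) := dom (Ordinal lti).
  by apply/(residual_covered v fk snd cpl)/pos; rewrite mem_iota ltn_ord.
apply: wp_block => //; first by rewrite /=; lia.
exists (all (fun i => 0 < R3 (base + i)) (iota 0 n)); split=> [|/okP dom|].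
- rewrite /env; exec_block; split; [by split | by [] | by [] |].
  by rewrite R4ok y7; case: a {z7 env1 env2 env3 y7}; case: all.
- by exists f.
case=> s' [f' [szs' eqs dom dec]]; apply/okP.
(* Both sequences have length [n + k] and the same value, hence coincide, so the function found in
   the registers is the one coded. *)
suff ff' : f =1 f' by move=> v; have [t [ft dt]] := dom v; exists t; rewrite ff'.
move=> v; rewrite /f R2E.
have -> : s = s' by apply: of_bits_inj eqs; rewrite szs.
by rewrite dec //; case: (f' v) => // m; rewrite addn1.
Qed.

Definition enumerate_time : nat :=
  4 * (n + k) + 2 ^ (n + k) * try_time.+2 + 5.

Lemma wp_enumerate R :
    R rone = 1 -> R rz = 0 -> R rn = n -> R rk = k -> R rans = 0 ->
  wp input enumerate_code enumerate_time (fun R' => exists b : bool,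
    R' rans = b /\ (b <-> broadcast_domination e k)) R.
Proof.
move=> z1 z2 z3 z4 z5.
apply: wp_block_seq => //; first by rewrite /enumerate_time /=; lia.
apply: (wp_seq (T1 := 4 * (n + k) + 1)) => /=; first by rewrite /enumerate_time; lia.
pose I i R' := env (2 ^ (n + k - i)) 0 R' /\ R' ri = i /\ i <= n + k.
apply: (@wp_while _ I (n + k) _ _ 2) => [i R' [_ []]//|i R'|R'||].
- case=> [[[y1 y2 y3 y4] y5 y6 y7] [yi lei]]; apply: wp_block => //.
  rewrite /I /env; exec_block; rewrite y6 yi y2.
  split; last by split; lia.
  split=> //; rewrite addnn -mul2n -expnS; congr (_ ^ _); lia.
- case=> Renv _; rewrite subn0 in Renv.
  (* The counter goes down, so the codes already tried are those from [i] up to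
     [2 ^ (n + k) - 1]. *)
  pose J i R' := exists b : bool, [/\ env i b R', b -> broadcast_domination e k,
    i <= 2 ^ (n + k) & forall N, is_code N -> i <= N < 2 ^ (n + k) -> b].
  apply: (@wp_while _ J (2 ^ (n + k)) _ _ try_time) => [i R2|i R2|R2||].
  + by case=> b [[]].
  + case=> b [Renv2 bT lei bN].
    apply: wp_mono (leqnn _) _ (wp_try lei Renv2) => R3 [b' [Renv3 b'T b'N]].
    exists (b || b'); split=> // [|| N codeN]; [by case/orP | exact: ltnW |].
    rewrite leq_eqVlt => /andP[/orP[/eqP eqN|ltN] ltN2]; apply/orP.
      by right; apply: b'N; rewrite eqN.
    by left; apply: (bN N) => //; rewrite ltN.
  + case=> b [[_ _ _ Rb] bT _ bN]; exists b; split=> //; split=> //.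
    by case/is_code_exists=> N codeN ltN; apply: (bN N) => //; rewrite ltN.
  + by rewrite /enumerate_time; lia.
  by exists false; split=> // N _; case: leqP => //; rewrite leqNgt => ->.
- by rewrite /=; lia.
by rewrite /I /env; exec_block; rewrite subnn z2 z3 z4 !addn0.
Qed.

(** * Maximum out-degree and the threshold on the order *)

Definition row_degree (i : nat) : nat :=
  \sum_(j < n) nth 0 input (2 + (i * n + j)).

Lemma max_row_degree : \max_(i < n) row_degree i = max_outdegree e.
Proof.
rewrite /max_outdegree; apply: eq_bigr => i _; rewrite /row_degree -sum1_card.
rewrite [RHS]big_mkcond; apply: eq_bigr => j _.
by rewrite nth_encode inE; case: (e i j).
Qed.

Definition prologue_env R : Prop :=
  [/\ [/\ R rz = 0, R rone = 1, R rn = n & R rk = k] & R rans = 0].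

Lemma wp_outdegree_row i v R :
    prologue_env R -> R ri = i.+1 -> R ridx = 2 + v * n ->
  wp input outdegree_row_code (6 * n + 6) (fun R' =>
    [/\ prologue_env R', R' ri = i, R' ridx = 2 + v.+1 * n
      & R' rD = maxn (R rD) (row_degree v)]) R.
Proof.
move=> [[z1 z2 z3 z4] z5] Ri Ridx; apply: wp_block_seq => //; first by rewrite /=; lia.
apply: (wp_seq (T1 := n * 6 + 1)) => /=; first by lia.
pose I j R' := [/\ prologue_env R', [/\ R' ri = i.+1, R' rj = j & R' rD = R rD]
  & exists w, [/\ w + j = n, R' ridx = 2 + (v * n + w)
    & R' racc = \sum_(0 <= j < w) nth 0 input (2 + (v * n + j))]].
apply: (@wp_while _ I n _ _ 4) => [j R' [_ []]//|j R'|R'||].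
- case=> [[[y1 y2 y3 y4] y5] [yi yj yD] [w [wj yidx yacc]]].
  apply: wp_block => //; rewrite /I /prologue_env; exec_block.
  rewrite yj yidx yacc y2; split=> //; first by split=> //; lia.
  exists w.+1; split; [lia | lia | by rewrite big_nat_recr].
- case=> [[[y1 y2 y3 y4] y5] [yi yj yD] [w [wj yidx yacc]]].
  have wE : w = n by lia.
  apply: wp_block => //; first by rewrite /=; lia.
  rewrite /prologue_env; exec_block; rewrite yi yD yacc y2 wE; split=> //.
  + by lia.
  + by rewrite yidx mulSn; lia.
  by rewrite big_mkord maxnE.
- by lia.
rewrite /I /prologue_env; exec_block; split=> //; first by split=> //; lia.
by exists 0; rewrite Ridx big_geq // !addn0.
Qed.

Lemma wp_power i R :
    prologue_env R -> R ri = i.+1 ->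
  wp input power_code (4 * R rD + 5) (fun R' =>
    [/\ prologue_env R', R' ri = i, R' rD = R rD & R' rw = R rD * R rw]) R.
Proof.
move=> [[z1 z2 z3 z4] z5] Ri; apply: wp_block_seq => //; first by rewrite /=; lia.
apply: (wp_seq (T1 := R rD * 4 + 1)) => /=; first by lia.
pose I j R' := [/\ prologue_env R',
  [/\ R' ri = i.+1, R' rj = j, R' rD = R rD & R' rw = R rw]
  & exists w, w + j = R rD /\ R' racc = w * R rw].
apply: (@wp_while _ I (R rD) _ _ 2) => [j R' [_ []]//|j R'|R'||].
- case=> [[[y1 y2 y3 y4] y5] [yi yj yD yw] [w [wj yacc]]].
  apply: wp_block => //; rewrite /I /prologue_env; exec_block.
  rewrite yj yacc yw y2; split=> //; first by split=> //; lia.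
  by exists w.+1; split; lia.
- case=> [[[y1 y2 y3 y4] y5] [yi yj yD yw] [w [wj yacc]]].
  have wE : w = R rD by lia.
  apply: wp_block => //; first by rewrite /=; lia.
  by rewrite /prologue_env; exec_block; rewrite yi yacc y1 y2 wE addn0; split=> //; lia.
- by lia.
rewrite /I /prologue_env; exec_block; split=> //; first by split=> //; lia.
by exists 0; split=> //; lia.
Qed.

Definition branching : nat := maxn 1 (max_outdegree e).

(** Charging the enumeration only below the threshold is what makes [enumeration_bound]
    applicable. *)
Definition main_time : nat :=
  n * (6 * n + 8) + k * (4 * branching + 7) + 13
  + (if n <= 2 * k * branching ^ k then enumerate_time else 0).

Lemma wp_main : wp input main_code main_time (fun R => exists b : bool,
  R rans = b /\ (b <-> broadcast_domination e k)) (fun=> 0).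
Proof.
apply: wp_block_seq => //; first by rewrite /main_time /=; lia.
apply: (wp_seq (T1 := n * (6 * n + 8) + 1)); first by rewrite /main_time /=; lia.
pose I i R := [/\ prologue_env R, R ri = i & exists v, [/\ v + i = n,
  R ridx = 2 + v * n & R rD = maxn 1 (\max_(0 <= u < v) row_degree u)]].
apply: (@wp_while _ I n _ _ (6 * n + 6)) => [i R []//|i R|R||].
- case=> y1 yi [v [vi yidx yD]].
  apply: wp_mono (leqnn _) _ (wp_outdegree_row y1 yi yidx) => R' [x1 xi xidx xD].
  split=> //; exists v.+1; split=> //; first by lia.
  by rewrite xD yD big_nat_recr //= maxnA.
- case=> [[[y1 y2 y3 y4] y5] yi [v [vi yidx yD]]].
  have {yD}RD : R rD = branching.
    have vE : v = n by lia.
    by rewrite yD vE big_mkord max_row_degree.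
  apply: wp_block_seq => //; first by rewrite /main_time /=; lia.
  apply: (wp_seq (T1 := k * (4 * branching + 7) + 1)); first by rewrite /main_time /=; lia.
  pose J i R' := [/\ prologue_env R', R' ri = i, R' rD = branching
    & exists j, j + i = k /\ R' rw = 2 * k * branching ^ j].
  apply: (@wp_while _ J k _ _ (4 * branching + 5)) => [i R' []//|i R'|R'||].
  + case=> x1 xi xD [j [ji xw]].
    have := wp_power x1 xi; rewrite xD; apply: wp_mono => // R2 [w1 wi wD ww].
    split=> //; exists j.+1; split; first by lia.
    by rewrite ww xw expnS mulnCA.
  + case=> [[[x1 x2 x3 x4] x5] xi xD [j [jk xw]]].
    have jE : j = k by lia.
    apply: wp_block_seq => //; first by rewrite /main_time /=; lia.
    rewrite {}jE in xw; case: (leqP n (2 * k * branching ^ k)) => [len|ltn].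
      apply: (@wp_mono _ _ enumerate_time.+1 _ _ _ _ _ (fun=> id)).
        by rewrite /main_time len /=; lia.
      apply: wp_when; exec_block; first by rewrite xw x2 x3; lia.
      by move=> _; apply: wp_enumerate.
    apply: (@wp_mono _ _ 1 _ _ _ _ _ (fun=> id)); first by rewrite /main_time /=; lia.
    apply: wp_when; exec_block; last by rewrite xw x2 x3; lia.
    move=> _; exists false; split=> //; split=> // -[f [dom lek]].
    have := order_le_broadcast (leq_maxl 1 _) (leq_maxr 1 _) dom lek.
    by rewrite card_ord leqNgt ltn.
  + by lia.
  rewrite /J /prologue_env; exec_block; rewrite y1 y4 addn0; split=> //.
  by exists 0; split=> //; lia.
- by rewrite /main_time /=; lia.
rewrite /I /prologue_env; exec_block; split=> //; first by rewrite addn0.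
by exists 0; split=> //; rewrite big_geq.
Qed.

End Verification.

(** The exponential part is absorbed by [2 ^ (n + k + k)], and the factor [k] of the prologue by
    [k < 2 * k ^ k]. *)
Lemma main_time_bound : exists C, forall n k (e : rel 'I_n), 0 < n ->
  main_time k e <= C * k ^ k * 2 ^ (max_outdegree e ^ (4 * k)) * n ^ 2.
Proof.
(* Generous constants: [2 * 27] suffices for the prologue and [4 + 24 * 4 + 2 + 5] for the
   enumeration. *)
have [C boundC] := enumeration_bound; exists (74 + 128 * C) => n k e n_gt0.
set d := max_outdegree e; set X := 2 ^ (d ^ (4 * k)).
have X_gt0 : 0 < X by rewrite expn_gt0.
have ltk : k < 2 * k ^ k.
  case: k {X X_gt0} => [//|k]; have : k.+1 ^ 1 <= k.+1 ^ k.+1 by rewrite leq_pexp2l.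
  lia.
have leDn : branching e <= n.
  rewrite /branching geq_max n_gt0 /=; apply/bigmax_leqP => v _.
  by apply: leq_trans (max_card _) _; rewrite card_ord.
have n2_gt0 : 0 < n ^ 2 by rewrite expn_gt0 n_gt0.
have le_n2 : n <= n ^ 2 by rewrite -mulnn leq_pmulr.
have -> : (74 + 128 * C) * k ^ k * X * n ^ 2 =
    74 * (k ^ k * X * n ^ 2) + 128 * (C * k ^ k * X * n ^ 2).
  by rewrite -!mulnA mulnDl -!mulnA.
apply: leq_add.
  (* Here 27 is [6 + 8 + 13], the terms free of [k]; those with a factor [k] only need [4 + 7]. *)
  apply: leq_trans (_ : 27 * (k.+1 * n ^ 2) <= _).
    have : k * branching e <= k * n ^ 2 by rewrite leq_mul2l (leq_trans leDn) ?orbT.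
    have : k <= k * n ^ 2 by rewrite leq_pmulr.
    have -> : n * (6 * n + 8) = 6 * n ^ 2 + 8 * n by rewrite -mulnn; lia.
    have -> : k * (4 * branching e + 7) = 4 * (k * branching e) + 7 * k by lia.
    by rewrite mulSn; lia.
  have le1 : k.+1 * n ^ 2 <= 2 * (k ^ k * n ^ 2) by rewrite mulnA leq_mul2r ltk orbT.
  have le2 : k ^ k * n ^ 2 <= k ^ k * X * n ^ 2 by rewrite leq_mul2r leq_pmulr ?orbT.
  lia.
case: (leqP n) => // len; have := boundC n k d n_gt0 len; rewrite -/X.
set Y := 2 ^ (n + k + k) => leY.
have Y_gt0 : 0 < Y by rewrite expn_gt0.
have le_nk : n + k <= Y.
  by apply: leq_trans (ltnW (ltn_expl _ (isT : 1 < 2))) _; rewrite leq_exp2l ?leq_addr.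
have leP2 : 2 ^ (n + k) * k.+1 <= Y.
  by rewrite /Y [2 ^ (n + k + k)]expnD leq_mul2l ltn_expl ?orbT.
have leP1 : 2 ^ (n + k) <= Y by apply: leq_trans leP2; rewrite leq_pmulr.
apply: leq_trans (_ : 128 * (Y * n ^ 2) <= _); last first.
  by rewrite leq_mul2l leq_mul2r leY !orbT.
have le_n1 : n.+1 ^ 2 <= 4 * n ^ 2 by rewrite -!mulnn; nia.
have leYn : Y <= Y * n ^ 2 by rewrite leq_pmulr.
have le_mul := leq_mul leP2 le_n1.
have -> : enumerate_time n k =
    4 * (n + k) + 24 * (2 ^ (n + k) * k.+1 * n.+1 ^ 2) + 2 * 2 ^ (n + k) + 5.
  by rewrite /enumerate_time /try_time; lia.
by rewrite [Y * (4 * _)]mulnCA in le_mul; lia.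
Qed.

Theorem theorem8 :
  exists (P : program) (C a b : nat),
  forall (n : nat) (e : rel 'I_n) (k : nat),
  0 < n -> weakly_connected e ->
  decides_within P (encode e k)
    (C * k ^ k * 2 ^ (max_outdegree e ^ (a * k)) * n ^ b)
    (broadcast_domination e k).
Proof.
have [C boundC] := main_time_bound.
exists (compile 0 main_code), C, 4, 2 => n e k n_gt0 _.
have [t [R [let_ [b [Rb bP]] run_]]] := wp_main k e.
exists t, b; rewrite /run run_ //; split=> //.
  exact: leq_trans let_ (boundC n k e n_gt0).
Qed.
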